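(* Let $\xi$ be an upwards driver generating a simple curve, and let $x_0\in\mathbb{R}$ be a point with $\tau(x_0;\xi)<\infty$. The hitting time $\tau:=\tau(x_0;\xi)$ satisfies $$\tau=\frac14\big(x_0^2-x(\tau)^2\big)-\int_0^\tau\frac{\xi(t)}{x(t)-\xi(t)}\,dt.$$ Furthermore, if $y_0=\varphi(x_0)$ is the image of $x_0$ under the conformal welding $\varphi$ generated by $\xi$, then $$\varphi(x_0)^2-x_0^2=4\int_0^\tau\frac{\xi(t)\,(y(t)-x(t))}{(\xi(t)-x(t))(y(t)-\xi(t))}\,dt.$$
   Context: A driver is a continuous function $\xi:[0,T]\to\mathbb{R}$. The upwards Loewner flow of $\xi$ in the upper half plane $\mathbb{H}$ is the solution of $\partial_t h_t(z)=\frac{-2}{h_t(z)-\xi(t)}$, $h_0(z)=z$, for $z\in\mathbb{H}$. The driver generates a simple curve if there is an injective continuous $\gamma:[0,T]\to\mathbb{H}\cup\{\xi(T)\}$ with $\gamma(0)=\xi(T)$ and $\gamma((0,T])\subset\mathbb{H}$ such that $h_T$ maps $\mathbb{H}$ conformally onto $\mathbb{H}\setminus\gamma((0,T])$. For real $x_0\ne\xi(0)$, $x(t)$ denotes the solution of $\dot x(t)=\frac{-2}{x(t)-\xi(t)}$, $x(0)=x_0$ (similarly $y(t)$ with $y(0)=y_0$). The hitting time is $\tau(x_0;\xi)=\inf\{t\ge0:\liminf_{s\nearrow t}|x(s)-\xi(s)|=0\}$ (with $t\in[0,T]$ and $\inf\emptyset=+\infty$), with $\tau(\xi(0);\xi)=0$;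 when finite, $x(t)$ extends continuously to $t=\tau(x_0;\xi)$ with $x(\tau)=\xi(\tau)$. When $\xi$ generates a simple curve, $\tau(\cdot;\xi)$ (where finite) is continuous and strictly monotone on each side of $\xi(0)$, and the conformal welding $\varphi$ maps each $x_0\le\xi(0)$ with $\tau(x_0;\xi)<\infty$ to the unique $\varphi(x_0)\ge\xi(0)$ with $\tau(\varphi(x_0);\xi)=\tau(x_0;\xi)$. *)

(* Defs.v *)
From mathcomp Require Import all_boot all_order all_algebra.
From mathcomp Require Import all_classical all_reals all_analysis.
From mathcomp Require Import complex.

Set Implicit Arguments.
Unset Strict Implicit.
Unset Printing Implicit Defensive.

Import Order.TTheory GRing.Theory Num.Theory.
Import numFieldNormedType.Exports.

Local Open Scope classical_set_scope.
Local Open Scope ring_scope.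

Definition upper_half_plane (R : realType) : set R[i]^o :=
  [set z | 0 < complex.Im z].
Arguments upper_half_plane : clear implicits.

(* A driver on [0, T] is a function R -> R, used only on [0, T].  As usual for
   classical solutions with continuous right-hand side, the differential
   equations below are imposed at interior times, together with continuity up
   to the endpoints of the time interval; the one-sided equations at the
   endpoints follow.  R[i]^o carries no normed module structure over R, so the
   time derivative is written as the limit of difference quotients, with real
   numbers injected into R[i] by _%:C. *)
Definition upward_loewner_flow (R : realType) (xi : R -> R) (T : R)
    (h : R -> R[i]^o -> R[i]^o) : Prop :=
  forall z, upper_half_plane R z ->
    [/\ h 0 z = z,
        {within `[0, T], continuous (fun t => h t z)},
        forall t, 0 <= t <= T -> upper_half_plane R (h t z) &
        forall t, 0 < t < T ->
          ((h s z - h t z) / (s - t)%:C%C : R[i]^o) @[s --> t^'] -->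
            (- 2%:R / (h t z - (xi t)%:C%C) : R[i]^o)].

Definition conformal_onto (R : realType) (U V : set R[i]^o)
    (f : R[i]^o -> R[i]^o) : Prop :=
  [/\ forall z, U z -> derivable f z 1, set_inj U f & f @` U = V].

Definition generates_simple_curve (R : realType) (xi : R -> R) (T : R) : Prop :=
  exists (h : R -> R[i]^o -> R[i]^o) (gamma : R -> R[i]^o),
    [/\ upward_loewner_flow xi T h,
        {within `[0, T], continuous gamma} /\ set_inj `[0, T] gamma,
        gamma 0 = (xi T)%:C%C,
        gamma @` `]0, T] `<=` upper_half_plane R &
        conformal_onto (upper_half_plane R)
          (upper_half_plane R `\` gamma @` `]0, T]) (h T)].

(* x solves the real Loewner equation started at x0 on [0, t[.  The condition
   x s <> xi s keeps the quotient meaningful, since division by 0 is total. *)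
Definition real_loewner_solution (R : realType) (xi : R -> R) (x0 t : R)
    (x : R -> R) : Prop :=
  [/\ x 0 = x0,
      {within `[0, t[, continuous x},
      forall s, 0 <= s < t -> x s <> xi s &
      forall s, 0 < s < t -> is_derive s 1 x (- 2%:R / (x s - xi s))].

(* The time 0 is excluded from the set: for x0 <> xi 0 there is no left limit
   at time 0 to consider.  The infimum of the empty set is +oo. *)
Definition hitting_time (R : realType) (xi : R -> R) (T x0 : R) : \bar R :=
  if x0 == xi 0 then 0%E else
  ereal_inf [set t%:E | t in [set t | 0 < t <= T /\
    exists x, real_loewner_solution xi x0 t x /\
      limf_einf (fun s => `|x s - xi s|%:E) t^'- = 0%E]].

(* x is the solution started at x0, continuously extended to its (finite)
   lifetime tau; for tau = 0 this only says that x 0 = x0. *)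
Definition extended_solution (R : realType) (xi : R -> R) (x0 tau : R)
    (x : R -> R) : Prop :=
  real_loewner_solution xi x0 tau x /\ {within `[0, tau], continuous x}.

(* The values of phi off the set of points x0 <= xi 0 with finite hitting time
   are irrelevant. *)
Definition conformal_welding (R : realType) (xi : R -> R) (T : R)
    (phi : R -> R) : Prop :=
  forall x0, x0 <= xi 0 -> (hitting_time xi T x0 < +oo)%E ->
    unique (fun y0 => xi 0 <= y0 /\ hitting_time xi T y0 = hitting_time xi T x0)
      (phi x0).

(* Main.v *)
Require Import Defs.
From mathcomp Require Import all_boot all_order all_algebra.
From mathcomp Require Import all_classical all_reals all_analysis.
From mathcomp Require Import complex.
From mathcomp Require Import measurable_realfun ring lra.

(** Along a trajectory, (x^2)' = 2 x x' = - 4 x / (x - xi) = - 4 - 4 xi / (x - xi),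
    and integrating over [0, tau] gives the formula for the hitting time
    ([loewner_sqr_identity]).  The integrand is unbounded near tau, where x meets
    xi.  It is nevertheless integrable, because x - xi never changes sign before
    tau: 1 / (x - xi) = - x' / 2 has constant sign and its primitive - x / 2 is
    continuous up to tau ([loewner_gap_inv_integrable]), while xi is bounded.

    The welding formula is the difference of the identities for x and y, which
    share the same tau.  The terms x(tau)^2 and y(tau)^2 cancel because both
    trajectories reach xi at time tau ([extended_solution_hits]).  The hitting
    time is defined as an infimum over all solutions started at x0, so this uses
    uniqueness for the real Loewner equation
    ([real_loewner_solution_unique]): it forces all admissible times to coincide,
    so that the infimum is attained ([hitting_time_attained]) by the given
    trajectory. *)

Set Implicit Arguments.
Unset Strict Implicit.

Import Order.TTheory GRing.Theory Num.Theory.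
Import numFieldNormedType.Exports.

Local Open Scope classical_set_scope.
Local Open Scope ring_scope.

(** * Integrals of derivatives that may be unbounded at an endpoint *)

(** Although f may blow up at b, its integrals over [a, c] with c < b are
    F c - F a, hence bounded by F b - F a since F is nondecreasing, and monotone
    convergence gives integrability up to b. *)
Lemma ge0_derive_integrable (R : realType) (F f : R -> R) (a b : R) :
  a < b -> {within `[a, b], continuous F} -> {within `[a, b[, continuous f} ->
  (forall s, a <= s < b -> 0 <= f s) ->
  (forall s, a < s < b -> is_derive s 1 F (f s)) ->
  lebesgue_measure.-integrable `[a, b[ (EFin \o f).
Proof.
move=> ab cF cf f0 dF.
have mf : measurable_fun (`[a, b[ : set R) f.
  by apply: subspace_continuous_measurable_fun.
have F_le c : a <= c <= b -> F c <= F b.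
  move=> /andP[ac cb].
  apply: (@ger0_derive1_le_cc _ F a b _ _ cF c b) => //.
  - by move=> s; rewrite in_itv/= => /dF[].
  - move=> s; rewrite in_itv/= => /[dup] sab /dF ds.
    rewrite derive1E derive_val f0//.
    by move: sab => /andP[/ltW -> ->].
  - by rewrite in_itv/= ac.
  - by rewrite in_itv/= lexx (ltW ab).
apply/integrableP; split; first exact/measurable_EFinP.
under eq_integral => s sab.
  rewrite /= ger0_norm; last first.
    by move: sab; rewrite inE/= in_itv/=; exact: f0.
  over.
pose D n := `[a, b - n.+1%:R^-1]%classic : set R.
have Dco n : D n `<=` `[a, b[.
  by apply: subset_itvl; rewrite bnd_simp ltrBlDr ltrDl invr_gt0.
rewrite (itv_bnd_open_bigcup true a b).
have Dcvg : (\int[lebesgue_measure]_(x in D i) (f x)%:E)%E @[i --> \oo] -->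
    (\int[lebesgue_measure]_(x in \bigcup_i D i) (f x)%:E)%E.
  apply: ge0_nondecreasing_set_cvg_integral.
  - move=> m n mn; rewrite /D; apply/subsetPset/subset_itvl.
    by rewrite bnd_simp lerB// lef_pV2 ?posrE// ler_nat ltnS.
  - by move=> n; exact: measurable_itv.
  - by move=> n; apply/measurable_EFinP; exact: measurable_funS (Dco n) mf.
  - by move=> n s /Dco; rewrite /= in_itv/= lee_fin; exact: f0.
apply: (@le_lt_trans _ _ (F b - F a)%:E); last exact: ltry.
rewrite -(cvg_lim _ Dcvg)//.
apply: lime_le; first by apply/cvg_ex; eexists; exact: Dcvg.
apply: nearW => n.
set c := b - n.+1%:R^-1.
have cb : c < b by rewrite /c ltrBlDr ltrDl invr_gt0.
(* For small n the point c may lie at or before a; the integral is then 0. *)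
have [ac|ca] := ltP a c; last first.
  move: ca; rewrite /D -/c le_eqVlt => /predU1P[->|ca].
    by rewrite set_itv1 integral_set1 lee_fin subr_ge0 F_le// lexx ltW.
  rewrite set_itv_ge -?leNgt ?bnd_simp// -?ltNge//.
  by rewrite integral_set0 lee_fin subr_ge0 F_le// lexx ltW.
rewrite /D -/c (@continuous_FTC2 _ f F)//.
- by rewrite -EFinB lee_fin lerB// F_le// (ltW ac) ltW.
- by apply: continuous_subspaceW cf; apply: subset_itvl; rewrite bnd_simp.
- have cac : {within `[a, c], continuous F}.
    by apply: continuous_subspaceW cF; apply: subset_itvl; rewrite bnd_simp ltW.
  move/(continuous_within_itvP _ ac) : cac => [_ Fa Fc]; split => // s.
  by rewrite in_itv/= => /andP[sa sc];
    have [] := dF s _; rewrite ?sa ?(lt_trans sc).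
- move=> s; rewrite in_itv/= => /andP[sa sc].
  have ds : is_derive s 1 F (f s) by apply: dF; rewrite sa (lt_trans sc).
  by rewrite derive1E derive_val.
Qed.

Lemma integrable_itv_bndo_bndc (R : realType) (a b : R) (f : R -> R) :
  lebesgue_measure.-integrable `[a, b[ (EFin \o f) ->
  lebesgue_measure.-integrable `[a, b] (EFin \o f).
Proof.
move=> /integrableP[mf fi]; apply/integrableP; split.
  apply/measurable_EFinP/measurable_fun_itv_bndo_bndcP.
  exact/measurable_EFinP.
rewrite -integral_itv_bndo_bndc//; apply: measurableT_comp => //.
Qed.

(** The fundamental theorem of calculus when f is only known to be integrable and
    continuous inside: the primitive u |-> int_a^u f is continuous up to the
    endpoints and has the same derivative as F inside, so that the mean value
    theorem applies to its difference with F. *)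
Lemma integrable_derive_Rintegral (R : realType) (F f : R -> R) (a b : R) :
  a < b -> {within `[a, b], continuous F} ->
  {in `]a, b[%R, continuous f} ->
  lebesgue_measure.-integrable `[a, b] (EFin \o f) ->
  (forall s, a < s < b -> is_derive s 1 F (f s)) ->
  \int[lebesgue_measure]_(t in `[a, b]) f t = F b - F a.
Proof.
move=> ab cF cf fi dF.
pose G := (fun u => \int[lebesgue_measure]_(t in `[a, u]) f t) - F.
have cG : {within `[a, b], continuous G}.
  apply: within_continuousB => //.
  exact: (parameterized_integral_continuous (ltW ab) fi).
have dG s : s \in `]a, b[%R -> is_derive s 1 G 0.
  move=> /[dup] sab; rewrite in_itv/= => /andP[sa sb].
  have [d1 d1E] := continuous_FTC1_closed sb fi sa (cf _ sab).
  rewrite -(subrr (f s)); apply: is_deriveB; last by apply: dF; rewrite sa.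
  by rewrite -d1E derive1E; exact/derivableP.
have [c _] := MVT ab dG cG.
rewrite mul0r => /eqP; rewrite subr_eq0 => /eqP.
rewrite /G !fctE set_itv1 Rintegral_set1 sub0r => /eqP.
by rewrite subr_eq addrC => /eqP.
Qed.

Lemma integrable_itv_refl (R : realType) (a : R) (f : R -> R) :
  lebesgue_measure.-integrable `[a, a] (EFin \o f).
Proof.
apply: continuous_compact_integrable; first exact: segment_compact.
by rewrite set_itv1; exact: continuous_subspace1.
Qed.

Lemma integrable_itvMl (R : realType) (xi f : R -> R) (a b : R) :
  {within `[a, b], continuous xi} ->
  lebesgue_measure.-integrable `[a, b] (EFin \o f) ->
  lebesgue_measure.-integrable `[a, b] (EFin \o (fun t => xi t * f t)).
Proof.
move=> cxi fi.
have mxi : measurable_fun (`[a, b] : set R) xi.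
  by apply: subspace_continuous_measurable_fun.
have bxi : [bounded xi t | t in (`[a, b] : set R)].
  have /compact_bounded[M [Mreal xiM]] :=
    continuous_compact cxi (@segment_compact _ a b).
  by exists M; split => // N /xiM xiN s sab; apply: xiN; exists s.
have := @integrableMr _ _ _ lebesgue_measure _ _ xi _ mxi bxi fi.
by apply.
Qed.

(** * Sign of the gap and uniqueness for the real Loewner equation *)

(** The product form of same sign avoids a case distinction on the side of xi 0
    on which a trajectory starts. *)
Lemma nonvanishing_same_sign (R : realType) (g : R -> R) (a b : R) :
  {within `[a, b[, continuous g} -> (forall s, a <= s < b -> g s <> 0) ->
  forall s, a <= s < b -> 0 < g a * g s.
Proof.
move=> cg g0 s /andP[sa sb]; rewrite ltNge; apply/negP => gas.
have cgs : {within `[a, s], continuous g}.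
  by apply: continuous_subspaceW cg; apply: subset_itvl.
have [] := @IVT _ g a s 0 sa cgs.
  rewrite ge_min le_max; move: gas.
  by case: (leP (g a) 0); case: (leP (g s) 0) => //=; nra.
move=> c; rewrite in_itv/= => /andP[ac cs].
by apply: g0; rewrite ac (le_lt_trans cs).
Qed.

Lemma within_continuousM (R : realType) (A : set R) (f g : R -> R) :
  {within A, continuous f} -> {within A, continuous g} ->
  {within A, continuous (f * g)}.
Proof. by move=> cf cg x; apply: cvgM; [exact: cf|exact: cg]. Qed.

Lemma loewner_gap_continuous (R : realType) (xi x : R -> R) (x0 T t : R) :
  {within `[0, T], continuous xi} -> t <= T ->
  real_loewner_solution xi x0 t x ->
  {within `[0, t[, continuous (x - xi)}.
Proof.
move=> cxi tT [_ cx _ _]; apply: within_continuousB => //.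
by apply: continuous_subspaceW cxi; apply: subset_itvl; rewrite bnd_simp.
Qed.

Lemma loewner_gap_same_sign (R : realType) (xi x : R -> R) (x0 T t : R) :
  {within `[0, T], continuous xi} -> t <= T ->
  real_loewner_solution xi x0 t x ->
  forall s, 0 <= s < t -> 0 < (x0 - xi 0) * (x s - xi s).
Proof.
move=> cxi tT xs s st.
have := nonvanishing_same_sign (loewner_gap_continuous cxi tT xs).
case: xs => <- _ x_ne _; apply=> // u /x_ne xu.
by rewrite !fctE => /eqP; rewrite subr_eq0 => /eqP.
Qed.

Lemma real_loewner_solutionS (R : realType) (xi x : R -> R) (x0 s t : R) :
  s <= t -> real_loewner_solution xi x0 t x -> real_loewner_solution xi x0 s x.
Proof.
move=> st [x_0 cx x_ne dx]; split => //.
- by apply: continuous_subspaceW cx; apply: subset_itvl; rewrite bnd_simp.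
- by move=> u /andP[u0 us]; apply: x_ne; rewrite u0 (lt_le_trans us).
- by move=> u /andP[u0 us]; apply: dx; rewrite u0 (lt_le_trans us).
Qed.

(** The right-hand side is singular at x = xi, but on [0, s] with s < t the gaps
    are bounded away from 0 by compactness and have a common sign, so that a
    Gronwall estimate is available. *)
Lemma real_loewner_solution_unique (R : realType) (xi x w : R -> R)
    (x0 T t : R) :
  {within `[0, T], continuous xi} -> t <= T ->
  real_loewner_solution xi x0 t x -> real_loewner_solution xi x0 t w ->
  forall s, 0 <= s < t -> x s = w s.
Proof.
move=> cxi tT xs ws s /andP[s0 st].
have st_sub : `[0, s] `<=` (`[0, t[ : set R).
  by apply: subset_itvl; rewrite bnd_simp.
have cA := continuous_subspaceW st_sub (loewner_gap_continuous cxi tT xs).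
have cB := continuous_subspaceW st_sub (loewner_gap_continuous cxi tT ws).
have [c cs c_min] := EVT_min s0 (within_continuousM cA cB).
have AB_gt0 u : 0 <= u <= s -> 0 < (x u - xi u) * (w u - xi u).
  move=> /andP[u0 us]; have ut : 0 <= u < t by rewrite u0 (le_lt_trans us).
  have hx := loewner_gap_same_sign cxi tT xs ut.
  have hw := loewner_gap_same_sign cxi tT ws ut.
  have := mulr_gt0 hx hw; rewrite mulrACA pmulr_rgt0// -expr2 exprn_even_gt0//=.
  by apply: contraTneq hx => ->; rewrite mul0r ltxx.
(* m is a positive lower bound for the product of the two gaps on [0, s]. *)
set m := (x c - xi c) * (w c - xi c).
have m_gt0 : 0 < m by apply: AB_gt0; move: cs; rewrite in_itv.
(* Gronwall: (x - w)' = 2 (x - w) / ((x - xi)(w - xi)), so (x - w)^2 grows at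
   most at rate 4 / m, and the damped square E is nonincreasing. *)
pose E : R -> R := (fun u => expR (- (4 / m) * u)) * (x - w) ^+ 2.
have [x_0 cx x_ne dx] := xs.
have [w_0 cw w_ne dw] := ws.
pose dE u := expR (- (4 / m) * u) *
  (4 * (x u - w u) ^+ 2 * (((x u - xi u) * (w u - xi u))^-1 - m^-1)).
have E_derive u : u \in `]0, s[ -> is_derive u 1 E (dE u).
  rewrite in_itv/= => /andP[u0 us].
  have ut : 0 < u < t by rewrite u0 (lt_trans us).
  have := dx u ut; have := dw u ut => ? ?.
  apply: is_derive_eq.
  rewrite /dE !fctE /= /GRing.scale/=.
  have ut' : 0 <= u < t by move: ut => /andP[/ltW -> ->].
  field; rewrite gt_eqF//= !subr_eq0.
  by apply/andP; split; apply/eqP; auto.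
have cE : {within `[0, s], continuous E}.
  rewrite /E expr2; apply: within_continuousM.
    apply: continuous_subspaceT => u.
    apply: continuous_comp; last exact: continuous_expR.
    exact: mulrl_continuous.
  by apply: within_continuousM; apply: continuous_subspaceW st_sub _;
    exact: within_continuousB.
have : E s <= E 0.
  apply: (@ler0_derive1_le_cc _ E 0 s _ _ cE).
  - by move=> u /E_derive[].
  - move=> u /[dup] us /E_derive d; rewrite derive1E derive_val /dE.
    rewrite pmulr_rle0 ?expR_gt0//.
    apply: mulr_ge0_le0; first by rewrite mulr_ge0 ?sqr_ge0.
    move: us; rewrite in_itv/= => /andP[u0 us].
    have uI : 0 <= u <= s by rewrite !ltW.
    rewrite subr_le0 lef_pV2 ?posrE//; last exact: AB_gt0.
    by apply: c_min; rewrite in_itv.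
  - by rewrite in_itv/= s0 lexx.
  - by rewrite in_itv/= s0 lexx.
  - exact: s0.
rewrite /E !fctE x_0 w_0 subrr expr0n/= mulr0 pmulr_rle0 ?expR_gt0//.
rewrite real_exprn_even_le0 ?num_real//= subr_eq0.
by move=> /eqP.
Qed.

(** * Hitting times are attained *)

Lemma limf_einf_ge_near (R : realType) (F : set_system R)
    (f : R -> \bar R) (c : \bar R) :
  (\forall s \near F, c <= f s)%E -> (c <= limf_einf f F)%E.
Proof.
move=> Fc; rewrite limf_einfE; apply: le_ereal_sup_tmp.
exists (ereal_inf (f @` [set s | (c <= f s)%E])).
  by exists [set s | (c <= f s)%E].
by apply: le_ereal_inf_tmp => _ [s ? <-].
Qed.

(** Used with g the gap of a solution reaching xi at time t and f the gap of a
    solution that stays away from it. *)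
Lemma limf_einf_norm_neq0 (R : realType) (f g : R -> R) (t l : R) :
  0 < t -> f s @[s --> t^'-] --> l -> l != 0 ->
  (forall s, 0 <= s < t -> g s = f s) ->
  limf_einf (fun s => `|g s|%:E) t^'- <> 0%E.
Proof.
move=> t0 fl l0 gE lim0.
have : ((`|l| / 2)%:E <= limf_einf (fun s => `|g s|%:E) t^'-)%E.
  apply: limf_einf_ge_near; near=> s.
  rewrite lee_fin gE; last first.
    apply/andP; split; first by near: s; exact: nbhs_left_ge.
    by near: s; exact: nbhs_left_lt.
  (* half of the limit leaves room for the strict inequality *)
  apply/ltW; near: s; apply: cvgr_gt (cvg_norm fl) _ _.
  by rewrite ltr_pdivrMr// ltr_pMr ?normr_gt0// ltr1n.
by rewrite lim0 lee_fin leNgt divr_gt0 ?normr_gt0.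
Unshelve. all: by end_near. Qed.

(** By uniqueness a trajectory has only one possible time of hitting xi, so the
    infimum ranges over a single time and is a minimum; in particular it is
    positive. *)
Lemma hitting_time_attained (R : realType) (xi : R -> R) (T x0 tau : R) :
  {within `[0, T], continuous xi} -> x0 != xi 0 ->
  hitting_time xi T x0 = tau%:E ->
  0 < tau <= T /\ exists x, real_loewner_solution xi x0 tau x /\
      limf_einf (fun s => `|x s - xi s|%:E) tau^'- = 0%E.
Proof.
move=> cxi x0N; rewrite /hitting_time (negbTE x0N).
set S := (X in [set _ | _ in X]) => infE.
have S_le u v : S u -> S v -> u <= v.
  move=> [/andP[_ uT] [x [xs _]]] [/andP[v0 vT] [w [ws w_lim]]].
  rewrite leNgt; apply/negP => vu.
  (* x is still alive at v, so x - xi has a nonzero limit there; but it agrees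
     with w - xi before v, whose lower limit at v is 0. *)
  have cv : {for v, continuous (x - xi)}.
    have cx := loewner_gap_continuous cxi uT xs.
    apply: (@within_continuous_continuous _ _ _ 0 ((v + u) / 2)).
    - by rewrite divr_gt0// addr_gt0 ?(lt_trans v0 vu).
    - apply: continuous_subspaceW cx; apply: subset_itvl.
      by rewrite bnd_simp midf_lt.
    - by rewrite in_itv/= v0 midf_lt.
  apply: (@limf_einf_norm_neq0 _ (x - xi) (w - xi) v (x v - xi v)) w_lim => //.
  - by apply: cvg_at_left_filter; exact: cv.
  - by rewrite subr_eq0; apply/eqP; case: xs => _ _ + _; apply; rewrite ltW.
  - move=> s sv; rewrite !fctE; congr (_ - _); apply/esym.
    have xs_v := real_loewner_solutionS (ltW vu) xs.
    exact: (real_loewner_solution_unique cxi vT xs_v ws).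
have [t St] : S !=set0.
  apply/set0P/negP => /eqP S0.
  by move: infE; rewrite S0 image_set0 ereal_inf0.
suff -> : tau = t by [].
have S1 : S = [set t].
  apply/seteqP; split=> [u Su|_ ->//]; apply/eqP.
  by rewrite eq_le !S_le.
by move: infE; rewrite S1 image_set1 ereal_inf1 => -[].
Qed.

(** The definition of the hitting time provides some solution with lower limit 0;
    by uniqueness it is x, and x - xi is continuous up to tau. *)
Lemma extended_solution_hits (R : realType) (xi x : R -> R) (T x0 tau : R) :
  {within `[0, T], continuous xi} -> x0 != xi 0 ->
  hitting_time xi T x0 = tau%:E -> extended_solution xi x0 tau x ->
  x tau = xi tau.
Proof.
move=> cxi x0N /(hitting_time_attained cxi x0N).
move=> [/andP[tau0 tauT] [w [ws w_lim]]].
move=> [xs cx]; apply: contrapT => /eqP; rewrite -subr_eq0 => gap_neq0.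
apply: (@limf_einf_norm_neq0 _ (x - xi) (w - xi) tau (x tau - xi tau)) w_lim =>
  //.
- have : {within `[0, tau], continuous (x - xi)}.
    apply: within_continuousB => //.
    by apply: continuous_subspaceW cxi; apply: subset_itvl.
  by move/(continuous_within_itvP _ tau0) => [].
- move=> s st; rewrite !fctE; congr (_ - _); apply/esym.
  exact: (real_loewner_solution_unique cxi tauT xs ws).
Qed.

(** * Integrating the square of a trajectory *)

(** The gap x - xi keeps a constant sign, so - x' / 2 = 1 / (x - xi) does as well,
    and a derivative of constant sign of a function continuous on [0, tau] is
    integrable, although here it is unbounded at the hitting time. *)
Lemma loewner_gap_inv_integrable (R : realType) (xi x : R -> R) (T x0 tau : R) :
  {within `[0, T], continuous xi} -> tau <= T -> 0 < tau ->
  extended_solution xi x0 tau x ->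
  lebesgue_measure.-integrable `[0, tau] (EFin \o (fun t => (x t - xi t)^-1)).
Proof.
move=> cxi tauT tau0 [xs cx].
have sgn := loewner_gap_same_sign cxi tauT xs.
have [_ _ x_ne dx] := xs.
set g0 := x0 - xi 0 in sgn.
have g0N : g0 != 0.
  have := sgn 0; rewrite lexx tau0 => /(_ isT).
  by apply: contraTneq => ->; rewrite mul0r ltxx.
have gap_neq0 s : 0 <= s < tau -> x s - xi s != 0.
  by move=> /x_ne /eqP; rewrite subr_eq0.
have cgap := loewner_gap_continuous cxi tauT xs.
(* The factor g0 has the sign of x - xi, so the function is nonnegative. *)
have int_g0 : lebesgue_measure.-integrable `[0, tau[
    (EFin \o (fun t => g0 / (x t - xi t))).
  apply: (@ge0_derive_integrable _ (fun t => - (g0 / 2) * x t) _ _ _ tau0).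
  - apply: within_continuousM; last exact: cx.
    by apply: continuous_subspaceT => ?; exact: cst_continuous.
  - apply/subspace_continuousP => s /= s_in.
    apply: cvgM; first exact: cvg_cst.
    apply: cvgV; first by apply: gap_neq0; move: s_in; rewrite in_itv.
    by move/subspace_continuousP : cgap; exact.
  - move=> s st; have := sgn s st => /ltW.
    have gN := gap_neq0 s st.
    have -> : g0 / (x s - xi s) = g0 * (x s - xi s) * (x s - xi s)^-1 ^+ 2.
      by field.
    by move=> ?; rewrite mulr_ge0 ?sqr_ge0.
  - move=> s st; have := dx s st => ?; apply: is_derive_eq.
    rewrite /GRing.scale/=; field.
    by apply: gap_neq0; move: st => /andP[/ltW -> ->].
apply: integrable_itv_bndo_bndc.
have := @integrableZl _ _ _ lebesgue_measure _ (measurable_itv `[0, tau[)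
  g0^-1 _ int_g0.
apply: eq_integrable => // s _ /=.
by rewrite -EFinM mulKf.
Qed.

Lemma loewner_sqr_identity (R : realType) (xi x : R -> R) (T x0 tau : R) :
  {within `[0, T], continuous xi} -> 0 < tau <= T ->
  extended_solution xi x0 tau x ->
  lebesgue_measure.-integrable `[0, tau]
      (EFin \o (fun t => xi t / (x t - xi t))) /\
   tau = 4%:R^-1 * (x0 ^+ 2 - x tau ^+ 2)
     - \int[lebesgue_measure]_(t in `[0, tau]) (xi t / (x t - xi t)).
Proof.
move=> cxi /andP[tau0 tauT] xe.
have xi_sub : {within `[0, tau], continuous xi}.
  by apply: continuous_subspaceW cxi; apply: subset_itvl.
have int_q := integrable_itvMl xi_sub
  (loewner_gap_inv_integrable cxi tauT tau0 xe).
split => //.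
have [xs cx] := xe; have [x_0 _ x_ne dx] := xs.
have gap_neq0 s : 0 < s < tau -> x s - xi s != 0.
  by move=> /andP[/ltW s0 st]; rewrite subr_eq0; apply/eqP/x_ne; rewrite s0.
have int_cst : lebesgue_measure.-integrable `[0, tau] (EFin \o (cst (-4 : R))).
  apply: continuous_compact_integrable; first exact: segment_compact.
  by apply: continuous_subspaceT => ?; exact: cst_continuous.
have int_4q := @integrableZl _ _ _ lebesgue_measure _
  (measurable_itv `[0, tau]) 4 _ int_q.
(* (x^2)' = 2 x x' = - 4 x / (x - xi), and x = (x - xi) + xi *)
have := @integrable_derive_Rintegral _ (x * x)
  (fun t => -4 - 4 * (xi t / (x t - xi t))) 0 tau tau0 _ _ _ _.
rewrite RintegralB// RintegralZl// Rintegral_cst//= lebesgue_measure_itv/=.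
rewrite lte_fin tau0.
rewrite /= subr0 !fctE x_0 => FTC.
suff : - (4) * tau
    - 4 * \int[lebesgue_measure]_(t in `[0, tau]) (xi t / (x t - xi t)) =
    x tau * x tau - x0 * x0 by lra.
apply: FTC.
- exact: within_continuousM.
- move=> s s_in; have s_oo : 0 < s < tau by move: s_in; rewrite in_itv.
  have cxi_s := within_continuous_continuous tau0 xi_sub s_in.
  have cx_s := within_continuous_continuous tau0 cx s_in.
  apply: cvgB; first exact: cvg_cst.
  apply: cvgM; first exact: cvg_cst.
  apply: cvgM => //; apply: cvgV; first exact: gap_neq0.
  exact: cvgB.
- exact: (@integrableB _ _ _ lebesgue_measure _ (measurable_itv `[0, tau]) _ _
            int_cst int_4q).
- move=> s st; have := dx s st => ?; apply: is_derive_eq.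
  rewrite /GRing.scale/=; field; exact: gap_neq0.
Qed.

(** * The welding formula *)

(** The welding formula is the difference of two instances of the formula for the
    hitting time; this is its integrand. *)
Lemma loewner_welding_integrand (R : realType) (xi x y : R -> R) (tau : R) :
  (forall s, 0 <= s < tau -> x s <> xi s) ->
  (forall s, 0 <= s < tau -> y s <> xi s) ->
  x tau = xi tau -> y tau = xi tau ->
  {in `[0, tau]%classic, forall t,
    xi t * (y t - x t) / ((xi t - x t) * (y t - xi t)) =
    xi t / (y t - xi t) - xi t / (x t - xi t)}.
Proof.
move=> x_ne y_ne xtau ytau t; rewrite inE/= in_itv/= => /andP[t0].
rewrite le_eqVlt => /predU1P[->|ttau].
  (* At the hitting time all quotients are divisions by 0, hence 0. *)
  by rewrite xtau ytau !subrr mulr0 !mul0r.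
have [] : x t <> xi t /\ y t <> xi t.
  by split; [apply: x_ne|apply: y_ne]; rewrite t0.
move=> /eqP xt /eqP yt.
by field; rewrite ?subr_eq0 // ?(eq_sym (xi t)) xt yt.
Qed.

Theorem lemma6p1 (R : realType) (T : R) (xi : R -> R) (x0 tau : R) (x : R -> R)
    (T_gt0 : 0 < T)
    (xi_cont : {within `[0, T], continuous xi})
    (xi_curve : generates_simple_curve xi T)
    (tauE : hitting_time xi T x0 = tau%:E)
    (x_sol : extended_solution xi x0 tau x) :
  (lebesgue_measure.-integrable `[0, tau]
      (EFin \o (fun t => xi t / (x t - xi t))) /\
   tau = 4%:R^-1 * (x0 ^+ 2 - x tau ^+ 2)
     - \int[lebesgue_measure]_(t in `[0, tau]) (xi t / (x t - xi t)))
  /\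
  (forall (phi y : R -> R),
     conformal_welding xi T phi ->
     x0 <= xi 0 ->
     extended_solution xi (phi x0) tau y ->
     lebesgue_measure.-integrable `[0, tau]
       (EFin \o (fun t => xi t * (y t - x t)
                            / ((xi t - x t) * (y t - xi t)))) /\
     phi x0 ^+ 2 - x0 ^+ 2 =
       4%:R * \int[lebesgue_measure]_(t in `[0, tau])
         (xi t * (y t - x t) / ((xi t - x t) * (y t - xi t)))).
Proof.
(* If x0 = xi 0, everything lives on a one-point interval, and phi x0 = x0
   because xi 0 itself has hitting time 0. *)
have [x0E|x0N] := eqVneq x0 (xi 0).
  have tau_eq0 : tau = 0.
    by move: tauE; rewrite /hitting_time x0E eqxx => -[].
  have x_0 : x 0 = x0 by case: x_sol => -[].
  rewrite tau_eq0 x_0; split=> [|phi y weld x0_le _].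
    split; first exact: integrable_itv_refl.
    by rewrite set_itv1 Rintegral_set1 subr0 subrr mulr0.
  split; first exact: integrable_itv_refl.
  have tau_fin : (hitting_time xi T x0 < +oo)%E by rewrite tauE ltry.
  have [_ phi_unique] := weld x0 x0_le tau_fin.
  have -> : phi x0 = x0 by rewrite [RHS]x0E; apply: phi_unique; rewrite -x0E.
  by rewrite set_itv1 Rintegral_set1 mulr0 subrr.
have [/[dup] tau_itv /andP[tau0 tauT] _] :=
  hitting_time_attained xi_cont x0N tauE.
have [x_int x_eq] := loewner_sqr_identity xi_cont tau_itv x_sol.
split=> // phi y weld x0_le y_sol.
have tau_fin : (hitting_time xi T x0 < +oo)%E by rewrite tauE ltry.
have [[_ phiE] _] := weld x0 x0_le tau_fin.
have y0E : hitting_time xi T (phi x0) = tau%:E by rewrite phiE.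
have y0N : phi x0 != xi 0.
  apply: contraTneq tau0 => phi_x0; rewrite -leNgt -lee_fin -y0E.
  by rewrite /hitting_time phi_x0 eqxx.
have [y_int y_eq] := loewner_sqr_identity xi_cont tau_itv y_sol.
have xtau := extended_solution_hits xi_cont x0N tauE x_sol.
have ytau := extended_solution_hits xi_cont y0N y0E y_sol.
have [[_ _ x_ne _] _] := x_sol.
have [[_ _ y_ne _] _] := y_sol.
have fE := loewner_welding_integrand x_ne y_ne xtau ytau.
split.
  have := @integrableB _ _ _ lebesgue_measure _ (measurable_itv `[0, tau]) _ _
    y_int x_int.
  by apply: eq_integrable => // t /fE /= ->.
under eq_Rintegral => t t_in do rewrite fE//.
rewrite RintegralB//.
rewrite xtau in x_eq; rewrite ytau in y_eq.
lra.
Qed.
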